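(* Let $\mathscr{X}$ be a Hilbert $C^*$-module over a $C^*$-algebra $\mathscr{A}$, and let $x,y_1,\dots,y_n\in\mathscr{X}$. Then $$\left(\sum_{i=1}^n|\langle y_i,x\rangle|^2\right)^2\le |x|^2\left\|\sum_{i=1}^n|\langle y_i,x\rangle|^2\right\|\max_{1\le i\le n}\sum_{j=1}^n\|\langle y_i,y_j\rangle\| .$$
   Context: A Hilbert $\mathscr{A}$-module over a $C^*$-algebra $\mathscr{A}$ is a complex linear space $\mathscr{X}$ that is a right $\mathscr{A}$-module with compatible scalar multiplication ($\lambda(xa)=x(\lambda a)=(\lambda x)a$), equipped with an $\mathscr{A}$-valued inner product $\langle\cdot,\cdot\rangle:\mathscr{X}\times\mathscr{X}\to\mathscr{A}$ satisfying: $\langle x,x\rangle\ge 0$, with $\langle x,x\rangle=0$ iff $x=0$; $\langle x,\lambda y+z\rangle=\lambda\langle x,y\rangle+\langle x,z\rangle$; $\langle x,ya\rangle=\langle x,y\rangle a$; $\langle x,y\rangle^*=\langle y,x\rangle$; and complete for the norm $\|x\|=\|\langle x,x\rangle\|^{1/2}$. (The inner product is thus linear in the second variable and conjugate-linear in the first.) For $x\in\mathscr{X}$, $|x|=\langle x,x\rangle^{1/2}\in\mathscr{A}$; for $a\in\mathscr{A}$, $|a|=(a^*a)^{1/2}$. Inequalities are in the usual order on self-adjoint elements of $\mathscr{A}$: $a\le b$ iff $b-a$ is positive. *)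

(* Defs.v *)
From HB Require Import structures.
From mathcomp Require Import all_boot all_order all_algebra.
From mathcomp Require Import complex.
From mathcomp Require Import all_classical all_reals all_analysis.

Set Implicit Arguments.
Unset Strict Implicit.
Unset Printing Implicit Defensive.

Import Order.TTheory GRing.Theory Num.Theory numFieldNormedType.Exports.

Local Open Scope classical_set_scope.
Local Open Scope ring_scope.

(* C*-algebras are not assumed to be unital, so the product cannot be that of
   the MathComp ring hierarchy, whose rings all have a unit.
   Norms of normed R[i]-modules take their values in R[i]; they are
   nonnegative, hence real, elements of R[i]. *)
HB.mixin Record isCStarAlgebra (R : realType) A
    of CompleteNormedModule R[i] A := {
  amul : A -> A -> A ;
  astar : A -> A ;
  amulA : forall a b c : A, amul a (amul b c) = amul (amul a b) c ;
  amulDl : forall a b c : A, amul (a + b) c = amul a c + amul b c ;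
  amulDr : forall a b c : A, amul a (b + c) = amul a b + amul a c ;
  amulZl : forall (l : R[i]) (a b : A), amul (l *: a) b = l *: amul a b ;
  amulZr : forall (l : R[i]) (a b : A), amul a (l *: b) = l *: amul a b ;
  astarK : forall a : A, astar (astar a) = a ;
  astarD : forall a b : A, astar (a + b) = astar a + astar b ;
  astarZ : forall (l : R[i]) (a : A), astar (l *: a) = l^* *: astar a ;
  astarM : forall a b : A, astar (amul a b) = amul (astar b) (astar a) ;
  norm_amul : forall a b : A, `|amul a b| <= `|a| * `|b| ;
  norm_astar_amul : forall a : A, `|amul (astar a) a| = `|a| ^+ 2
}.

#[short(type="cstarAlgType")]
HB.structure Definition CStarAlgebra (R : realType) :=
  { A of isCStarAlgebra R A & CompleteNormedModule R[i] A }.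

Section CStarAlgebraTheory.
Variables (R : realType) (A : cstarAlgType R).
Implicit Types (a b : A) (l : R[i]).

(* Product and unit of the unitization of A, whose element (a, l) stands for
   the formal sum a + l1. *)
Definition unitz_mul (u v : A * R[i]) : A * R[i] :=
  (amul u.1 v.1 + u.2 *: v.1 + v.2 *: u.1, u.2 * v.2).

Definition unitz_one : A * R[i] := (0, 1).

Definition unitz_invertible (u : A * R[i]) : Prop :=
  exists v, unitz_mul u v = unitz_one /\ unitz_mul v u = unitz_one.

(* The spectrum is taken in the unitization even when A has a unit, which can
   only add the point 0 to the spectrum relative to A. *)
Definition spectrum a : set R[i] := [set l | ~ unitz_invertible (a, - l)].

(* In R[i], 0 <= l means that l is real and nonnegative. *)
Definition apositive a : Prop :=
  astar a = a /\ forall l, spectrum a l -> 0 <= l.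

Definition ale a b : Prop := apositive (b - a).

(* The positive square root of a; it exists and is unique for positive a, and
   the value is irrelevant otherwise. *)
Definition asqrt a : A := xget 0 [set b | apositive b /\ amul b b = a].

Definition aabs a : A := asqrt (amul (astar a) a).

Definition asqr a : A := amul a a.

End CStarAlgebraTheory.

(* Completeness is spelled out with sequences, for the norm
   sqrt `|<x, x>|: no norm is presupposed on X, since the triangle inequality
   for this one is a theorem. *)
HB.mixin Record isHilbertModule (R : realType) (A : cstarAlgType R) X
    of GRing.Lmodule R[i] X := {
  ract : X -> A -> X ;
  inner : X -> X -> A ;
  ractDl : forall (x y : X) (a : A), ract (x + y) a = ract x a + ract y a ;
  ractDr : forall (x : X) (a b : A), ract x (a + b) = ract x a + ract x b ;
  ractM : forall (x : X) (a b : A), ract x (amul a b) = ract (ract x a) b ;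
  ractZl : forall (l : R[i]) (x : X) (a : A), l *: ract x a = ract (l *: x) a ;
  ractZr : forall (l : R[i]) (x : X) (a : A), l *: ract x a = ract x (l *: a) ;
  inner_ge0 : forall x : X, apositive (inner x x) ;
  inner_eq0 : forall x : X, inner x x = 0 <-> x = 0 ;
  inner_linear : forall (l : R[i]) (x y z : X),
    inner x (l *: y + z) = l *: inner x y + inner x z ;
  inner_ract : forall (x y : X) (a : A),
    inner x (ract y a) = amul (inner x y) a ;
  inner_star : forall x y : X, astar (inner x y) = inner y x ;
  hilbert_complete : forall u : nat -> X,
    (forall e : R[i], 0 < e -> exists N : nat, forall m n : nat,
      (N <= m)%N -> (N <= n)%N ->
      sqrtC `|inner (u m - u n) (u m - u n)| < e) ->
    exists x : X, forall e : R[i], 0 < e -> exists N : nat, forall n : nat,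
      (N <= n)%N -> sqrtC `|inner (u n - x) (u n - x)| < e
}.

#[short(type="hilbertModType")]
HB.structure Definition HilbertModule (R : realType) (A : cstarAlgType R) :=
  { X of isHilbertModule R A X & GRing.Lmodule R[i] X }.

Definition mabs (R : realType) (A : cstarAlgType R) (X : hilbertModType A)
    (x : X) : A := asqrt (inner x x : A).

(* Main.v *)
Require Import Defs.
From HB Require Import structures.
From mathcomp Require Import all_boot all_order all_algebra.
From mathcomp Require Import complex ring lra.
From mathcomp Require Import all_classical all_reals all_analysis.
Import Order.TTheory GRing.Theory Num.Theory numFieldNormedType.Exports.
Local Open Scope classical_set_scope.
Local Open Scope ring_scope.

Set Implicit Arguments.
Unset Strict Implicit.
Unset Printing Implicit Defensive.

(** Write [a_i] for [<y_i, x>] and put [z := sum_i y_i a_i].  Then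
[S := sum_i |a_i|^2 = <x, z>], and [S] is self-adjoint, so that
[S^2 = <x, z> <z, x>].  The Cauchy-Schwarz inequality of Hilbert modules gives
[S^2 <= K <x, x>] for every real [K >= ||<z, z>||] ([cauchy_schwarz]).
Moreover [<z, z> = sum_ij a_i^* <y_i, y_j> a_j], and every cross term satisfies
[a^* g b + b^* g^* a <= ||g|| (a^* a + b^* b)] ([pos_cross]); summing over all
pairs yields [<z, z> <= m S] with [m] the largest row sum of the norms
[||<y_i, y_j>||] ([pos_gram]), hence [||<z, z>|| <= m ||S||] because the norm
is monotone on positive elements ([pos_cnorm_le]).  So [K = m ||S||] works.

The bulk of the development is the order theory of C*-algebras on which this
argument rests.  It is carried out in a unital C*-algebra, and applied to the
unitization [A * R[i]] under the maximum of the operator norm of left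
multiplication on [A] and of the modulus of the scalar part; this is a
complete C*-norm that extends that of [A], whether or not [A] has a unit.

Neither the continuous functional calculus nor the spectral radius formula is
used.  Positivity is handled through the metric condition
[||t - h|| <= t] for some real [t] ([pos]), which is visibly stable under
sums.  Three facts make it work.
- Such an [h] has a positive square root, limit of a polynomial iteration
  ([pos_sqrt]).
- If [b] and [c] are commuting self-adjoint elements with [b^2 + c^2 = r],
  then [u := b + i c] satisfies [u^* u = r], so [||b^2|| <= r]
  ([cnorm_sqr_le]).  This makes squares positive, the cone closed and the norm
  monotone.
- If [h + s] is invertible for all real [s > 0], then [h] is positive: the
  infimum of the [t > 0] with [h + t] positive has to be [0], since a positive
  invertible element stays positive after subtracting a small scalar
  ([pos_resolvent]).
The last fact identifies [pos] with positivity defined by the spectrum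
([apositiveP]), and also drives the proof that [v^* v] is always positive
([pos_starM]). *)

(** * Unital C*-algebras *)

(** The norm takes its values in [R] rather than in [R[i]], so that suprema,
infima and real arithmetic are available for it. *)
HB.mixin Record isUnitalCStar (R : realType) U of GRing.Algebra R[i] U := {
  cnorm : U -> R ;
  star : U -> U ;
  starK : involutive star ;
  starD : {morph star : a b / a + b} ;
  starZ : forall (l : R[i]) (a : U), star (l *: a) = l^* *: star a ;
  starM : forall a b : U, star (a * b) = star b * star a ;
  cnormD_le : forall a b : U, cnorm (a + b) <= cnorm a + cnorm b ;
  cnormZ : forall (l : R[i]) (a : U),
    cnorm (l *: a) = complex.Re `|l| * cnorm a ;
  cnorm_eq0 : forall a : U, cnorm a = 0 -> a = 0 ;
  cnormM_le : forall a b : U, cnorm (a * b) <= cnorm a * cnorm b ;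
  cnorm_starM : forall a : U, cnorm (star a * a) = cnorm a ^+ 2 ;
  cnorm_complete : forall u : nat -> U,
    (forall e : R, 0 < e -> exists N : nat, forall m n : nat,
      (N <= m)%N -> (N <= n)%N -> cnorm (u m - u n) < e) ->
    exists v : U, forall e : R, 0 < e -> exists N : nat, forall n : nat,
      (N <= n)%N -> cnorm (u n - v) < e
}.

#[short(type="unitalCStarType")]
HB.structure Definition UnitalCStar (R : realType) :=
  { U of isUnitalCStar R U & GRing.Algebra R[i] U }.

Local Notation "r %:C" := (real_complex _ r) (at level 1, format "r %:C").

Section ComplexModulus.
Variable R : realType.
Implicit Types (r : R) (l : R[i]).

Lemma normc_real r : `|r%:C| = `|r|%:C.
Proof. by rewrite normc_def /= expr0n /= addr0 sqrtr_sqr. Qed.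

Lemma conj_real r : (r%:C : R[i])^* = r%:C.
Proof. by apply/CrealP; apply/complex_realP; exists r. Qed.

Lemma ReNormK l : (complex.Re `|l|)%:C = `|l|.
Proof. by rewrite RRe_real // normr_real. Qed.

End ComplexModulus.

(** * Norm, involution and limits *)

Section Basics.
Variables (R : realType) (U : unitalCStarType R).
Implicit Types (a b h k : U) (r s t : R).

Lemma cnormZr r a : cnorm (r%:C *: a) = `|r| * cnorm a.
Proof. by rewrite cnormZ normc_real. Qed.

Lemma cnorm0 : cnorm (0 : U) = 0.
Proof. by rewrite -(scale0r (0 : U)) cnormZ normr0 mul0r. Qed.

Lemma cnormN a : cnorm (- a) = cnorm a.
Proof. by rewrite -scaleN1r cnormZ normrN1 /= mul1r. Qed.

Lemma cnormB a b : cnorm (a - b) = cnorm (b - a).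
Proof. by rewrite -cnormN opprB. Qed.

Lemma cnormB_le a b : cnorm (a - b) <= cnorm a + cnorm b.
Proof. by rewrite (le_trans (cnormD_le _ _))// cnormN. Qed.

Lemma cnorm_ge0 a : 0 <= cnorm a.
Proof. by have := cnormB_le a a; rewrite subrr cnorm0; lra. Qed.

Lemma star0 : star (0 : U) = 0.
Proof. by apply: (addrI (star 0)); rewrite -starD !addr0. Qed.

Lemma starN a : star (- a) = - star a.
Proof. by rewrite -scaleN1r starZ rmorphN1 scaleN1r. Qed.

Lemma starB a b : star (a - b) = star a - star b.
Proof. by rewrite starD starN. Qed.

Lemma starZr r a : star (r%:C *: a) = r%:C *: star a.
Proof. by rewrite starZ conj_real. Qed.

Lemma star1 : star (1 : U) = 1.
Proof.
have := starM (star 1 : U) 1.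
by rewrite mulr1 starK mulr1 => <-.
Qed.

Lemma cnorm1 : cnorm (1 : U) = 1.
Proof.
have := cnorm_starM (1 : U); rewrite star1 mulr1 => e.
have [/cnorm_eq0/eqP|/eqP n0] := eqVneq (cnorm (1 : U)) 0.
  by rewrite oner_eq0.
by apply: (mulfI (introN eqP n0)); rewrite mulr1 -expr2 -e.
Qed.

(** By the C*-identity, [||a||^2 = ||a^* a|| <= ||a^*|| ||a||]. *)
Lemma cnorm_star a : cnorm (star a) = cnorm a.
Proof.
suff le (x : U) : cnorm x <= cnorm (star x).
  by apply/eqP; rewrite eq_le le andbT -{2}(starK a) le.
have [->|x0] := eqVneq (cnorm x) 0; first exact: cnorm_ge0.
have xp : 0 < cnorm x by rewrite lt_neqAle eq_sym x0 cnorm_ge0.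
by rewrite -(ler_pM2r xp) -expr2 -cnorm_starM cnormM_le.
Qed.

Lemma cnorm_sqr a : star a = a -> cnorm (a * a) = cnorm a ^+ 2.
Proof. by move=> sa; rewrite -{1}sa cnorm_starM. Qed.

Lemma sqr_eq0 a : star a = a -> a * a = 0 -> a = 0.
Proof.
move=> sa aa0; apply: cnorm_eq0; apply/eqP; rewrite -sqrf_eq0.
by rewrite -cnorm_sqr// aa0 cnorm0.
Qed.

Lemma cnormX_le a n : cnorm (a ^+ n) <= cnorm a ^+ n.
Proof.
elim: n => [|n IHn]; first by rewrite !expr0 cnorm1.
by rewrite !exprS (le_trans (cnormM_le _ _))// ler_wpM2l// cnorm_ge0.
Qed.

Lemma cnorm_scalar r : cnorm (r%:C%:A : U) = `|r|.
Proof. by rewrite cnormZr cnorm1 mulr1. Qed.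

Lemma star_scalar r : star (r%:C%:A : U) = r%:C%:A.
Proof. by rewrite starZr star1. Qed.

Definition converges (u : nat -> U) (v : U) :=
  (fun n => cnorm (u n - v)) @ \oo --> (0 : R).

Lemma null_add (d e : nat -> R) : d @ \oo --> (0 : R) ->
  e @ \oo --> (0 : R) -> (fun n => d n + e n) @ \oo --> (0 : R).
Proof. by move=> d0 e0; rewrite -[X in _ --> X]addr0; exact: cvgD. Qed.

Lemma null_mul (d e : nat -> R) (l : R) : d @ \oo --> (0 : R) ->
  e @ \oo --> l -> (fun n => d n * e n) @ \oo --> (0 : R).
Proof. by move=> d0 e0; rewrite -[X in _ --> X](mul0r l); exact: cvgM. Qed.

Lemma converges_squeeze u v (d : nat -> R) :
  (forall n, cnorm (u n - v) <= d n) -> d @ \oo --> (0 : R) -> converges u v.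
Proof.
move=> ud d0; apply: (squeeze_cvgr _ (cvg_cst 0) d0).
by apply: nearW => n; rewrite cnorm_ge0 ud.
Qed.

Lemma converges_unique u v w : converges u v -> converges u w -> v = w.
Proof.
move=> uv uw; apply/eqP; rewrite -subr_eq0; apply/eqP/cnorm_eq0.
apply/eqP; rewrite eq_le cnorm_ge0 andbT.
apply: (cvgr_to_ge (null_add uv uw)).
apply: nearW => n; rewrite -(cnormB v).
by rewrite (le_trans _ (cnormD_le _ _))// addrA subrK.
Qed.

Lemma converges_cnorm_le u v r : converges u v -> (forall n, cnorm (u n) <= r) ->
  cnorm v <= r.
Proof.
move=> uv ur; 
have c : (fun n => cnorm (u n - v) + r) @ \oo --> r.
  by rewrite -[X in _ --> X]add0r; exact: cvgD uv (cvg_cst r).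
apply: (cvgr_to_ge c).
apply: nearW => n.
rewrite (le_trans _ (lerD (lexx _) (ur n)))// cnormB.
by rewrite (le_trans _ (cnormD_le _ _))// subrK.
Qed.

Lemma converges_cst v : converges (fun=> v) v.
Proof. by rewrite /converges subrr cnorm0; exact: cvg_cst. Qed.

Lemma converges_shift u v : converges u v -> converges (fun n => u n.+1) v.
Proof.
by rewrite /converges => uv; rewrite (cvg_shiftS (fun n => cnorm (u n - v))).
Qed.

Lemma convergesD u v w z : converges u v -> converges w z ->
  converges (fun n => u n + w n) (v + z).
Proof.
move=> uv wz; apply: converges_squeeze (null_add uv wz) => n.
by rewrite opprD addrACA cnormD_le.
Qed.

Lemma convergesZ r u v : converges u v ->
  converges (fun n => r%:C *: u n) (r%:C *: v).
Proof.
move=> uv; apply: converges_squeeze (null_mul uv (cvg_cst `|r|)) => n.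
by rewrite mulrC -scalerBr cnormZr.
Qed.

Lemma converges_star u v : converges u v ->
  converges (fun n => star (u n)) (star v).
Proof. by rewrite /converges => uv; under eq_fun do rewrite -starB cnorm_star. Qed.

Lemma convergesM u v w z : converges u v -> converges w z ->
  converges (fun n => u n * w n) (v * z).
Proof.
move=> uv wz.
apply: converges_squeeze (null_add (null_add (null_mul uv wz)
  (null_mul uv (cvg_cst (cnorm z)))) (null_mul wz (cvg_cst (cnorm v)))) => n.
have -> : u n * w n - v * z = (u n - v) * (w n - z) + (u n - v) * z
    + v * (w n - z).
  by rewrite -mulrDr subrK mulrBl mulrBr addrA subrK.
rewrite (le_trans (cnormD_le _ _))// lerD//; last by rewrite mulrC cnormM_le.
by rewrite (le_trans (cnormD_le _ _))// lerD ?cnormM_le.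
Qed.

Lemma converges_commute u v h : converges u v -> (forall n, h * u n = u n * h) ->
  h * v = v * h.
Proof.
move=> uv hu; apply: (@converges_unique (fun n => h * u n)).
  exact: convergesM (converges_cst h) uv.
by under eq_fun do rewrite hu; exact: convergesM uv (converges_cst h).
Qed.

(** Comparing increments with those of a bounded real sequence is how all the
limits below are shown to exist: first those of the real sequence telescope,
then completeness applies. *)
Lemma converges_telescope (u : nat -> U) (r : nat -> R) B :
  (forall n, cnorm (u n.+1 - u n) <= r n.+1 - r n) ->
  (forall n, r n <= B) -> exists v, converges u v.
Proof.
move=> ur rB.
have ndr : nondecreasing_seq r.
  apply/nondecreasing_seqP => n.
  by rewrite -subr_ge0 (le_trans _ (ur n))// cnorm_ge0.
have cr : cvgn r.
  by apply: nondecreasing_is_cvgn => //; exists B => _ [n _ <-].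
have urD m (k : nat) : cnorm (u (m + k)%N - u m) <= r (m + k)%N - r m.
  elim: k => [|k IHk]; first by rewrite addn0 !subrr cnorm0.
  rewrite addnS -(subrK (u (m + k)%N) (u _.+1)) -addrA.
  rewrite (le_trans (cnormD_le _ _))// (le_trans (lerD (ur _) IHk))//.
  by rewrite addrA subrK.
have [v uv] : exists v : U, forall e : R, 0 < e -> exists N : nat,
    forall n : nat, (N <= n)%N -> cnorm (u n - v) < e.
  apply: cnorm_complete => e e0.
  have /cvgrPdist_lt/(_ e e0)[N _ rN] := cr.
  have close m n : (N <= m)%N -> (m <= n)%N -> cnorm (u n - u m) < e.
    move=> Nm mn; rewrite -(subnKC mn) (le_lt_trans (urD _ _))// subnKC//.
    have := rN m Nm; rewrite /= ger0_norm ?subr_ge0 ?nondecreasing_cvgn_le//.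
    have := nondecreasing_cvgn_le ndr cr n; lra.
  exists N => m n Nm Nn; have [mn|/ltnW nm] := leqP m n.
    by rewrite cnormB close.
  exact: close.
exists v; apply/cvgrPdist_lt => e e0; have [N uN] := uv e e0.
by exists N => // n Nn; rewrite sub0r normrN ger0_norm ?cnorm_ge0// uN.
Qed.

Definition invertible a := exists d, a * d = 1 /\ d * a = 1.

Lemma invertibleZ r a : r != 0 -> invertible a -> invertible (r%:C *: a).
Proof.
move=> r0 [d [ad da]]; have rr : (r%:C : R[i]) * r^-1%:C = 1.
  by rewrite -rmorphM divff.
by exists (r^-1%:C *: d); rewrite -!scalerAl -!scalerAr !scalerA ad da
  (mulrC r^-1%:C) rr scale1r.
Qed.

(** The inverse is the sum of the geometric series of [a]. *)
Lemma neumann a : cnorm a < 1 -> invertible (1 - a).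
Proof.
move=> a1; set q := cnorm a in a1; have q0 : 0 <= q := cnorm_ge0 a.
pose u n : U := \sum_(k < n) a ^+ k; pose r n : R := \sum_(k < n) q ^+ k.
have uE n : (1 - a) * u n = 1 - a ^+ n.
  rewrite -opprB mulNr -[RHS]opprB; congr (- _).
  by rewrite subrX1.
have rE n : (1 - q) * r n = 1 - q ^+ n.
  by rewrite -opprB mulNr -[RHS]opprB subrX1.
have [v uv] : exists v, converges u v.
  apply: (@converges_telescope _ r (1 - q)^-1) => n.
    by rewrite /u /r !big_ord_recr /= !(addrC _ (_ ^+ n)) !addrK cnormX_le.
  rewrite -(ler_pM2l (_ : 0 < 1 - q)) ?subr_gt0// rE divff ?subr_eq0 ?gt_eqF//.
  by rewrite gerBl exprn_ge0.
have aX0 : converges (fun n => 1 - a ^+ n) 1.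
  apply: (@converges_squeeze _ _ (fun n => q ^+ n)).
    by move=> n; rewrite addrC addKr cnormN cnormX_le.
  by apply: cvg_expr; rewrite ger0_norm.
have au n : a * u n = u n * a.
  by rewrite /u mulr_sumr mulr_suml; apply: eq_bigr => k _; rewrite -exprS exprSr.
have E : (1 - a) * v = 1.
  apply: (@converges_unique (fun n => 1 - a ^+ n)) => //.
  by under eq_fun do rewrite -uE; exact: convergesM (converges_cst _) uv.
exists v; split=> //; rewrite -[RHS]E mulrBr mulrBl mulr1 mul1r.
by congr (_ - _); apply/esym; exact: converges_commute uv au.
Qed.

End Basics.

(** * The positive cone *)

Section Positive.
Variables (R : realType) (U : unitalCStarType R).
Implicit Types (a b c h k v w : U) (r s t : R).

Lemma scale_half2 (a : U) : (2^-1 : R)%:C *: (a + a) = a.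
Proof.
rewrite -mulr2n -[X in _ *: X]scaler_nat scalerA.
have -> : (2^-1 : R)%:C * 2%:R = 1.
  by rewrite -(rmorph_nat (real_complex R)) -rmorphM mulVf ?pnatr_eq0.
by rewrite scale1r.
Qed.

(** The fixed points [y] of [y |-> (x + y^2) / 2] are the solutions of
[(1 - y)^2 = 1 - x].  Starting from [0], the iterates are polynomials in [x]
with nonnegative coefficients. *)
Fixpoint sqrt_iter (x : U) n : U :=
  if n is m.+1 then (2^-1 : R)%:C *: (x + sqrt_iter x m * sqrt_iter x m) else 0.

(** The same iteration at [x = 1] in [R]: it increases to [1], and dominates the
norms of the iterates, and its increments those of their increments, whenever
[||x|| <= 1]. *)
Fixpoint sqrt_bound n : R :=
  if n is m.+1 then 2^-1 * (1 + sqrt_bound m * sqrt_bound m) else 0.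

Lemma sqrt_bound_itv n : 0 <= sqrt_bound n <= 1.
Proof.
elim: n => [|n /andP[n0 n1]] /=; first by rewrite lexx ler01.
by apply/andP; split; nra.
Qed.

Lemma commuteD a b k : k * a = a * k -> k * b = b * k ->
  k * (a + b) = (a + b) * k.
Proof. by rewrite mulrDr mulrDl => -> ->. Qed.

Lemma commuteN a k : k * a = a * k -> k * (- a) = (- a) * k.
Proof. by rewrite mulrN mulNr => ->. Qed.

Lemma commuteB a b k : k * a = a * k -> k * b = b * k ->
  k * (a - b) = (a - b) * k.
Proof. by move=> ka kb; apply/commuteD/commuteN. Qed.

Lemma commuteM a b k : k * a = a * k -> k * b = b * k ->
  k * (a * b) = (a * b) * k.
Proof. by move=> ka kb; rewrite mulrA ka -!mulrA kb. Qed.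

Lemma commuteZ (l : R[i]) a k : k * a = a * k -> k * (l *: a) = (l *: a) * k.
Proof. by rewrite -scalerAl -scalerAr => ->. Qed.

Lemma commute_scalar (l : R[i]) k : k * l%:A = l%:A * k.
Proof. by apply: commuteZ; rewrite mulr1 mul1r. Qed.

Lemma sqrt_iter_commute x k n : k * x = x * k ->
  k * sqrt_iter x n = sqrt_iter x n * k.
Proof.
move=> kx; elim: n => [|n IHn] /=; first by rewrite mulr0 mul0r.
by apply/commuteZ/commuteD => //; apply: commuteM.
Qed.

(** The increments satisfy
[u (n+2) - u (n+1) = (u (n+1) - u n) (u (n+1) + u n) / 2] because all iterates
commute, and the same recurrence holds for the dominating real sequence. *)
Lemma sqrt_one_sub x : star x = x -> cnorm x <= 1 ->
  exists y, [/\ star y = y, cnorm y <= 1, (1 - y) * (1 - y) = 1 - x &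
    forall k, k * x = x * k -> k * y = y * k].
Proof.
move=> sx x1; pose u := sqrt_iter x; pose r := sqrt_bound.
have uu m n : u m * u n = u n * u m.
  by apply/sqrt_iter_commute/esym/sqrt_iter_commute.
have ur n : cnorm (u n) <= r n.
  elim: n => [|n IHn]; first by rewrite cnorm0.
  rewrite /= cnormZr ger0_norm ?invr_ge0 ?ler0n// ler_pM2l ?invr_gt0 ?ltr0n//.
  rewrite (le_trans (cnormD_le _ _))// lerD//.
  by rewrite (le_trans (cnormM_le _ _))// ler_pM// cnorm_ge0.
have du n : cnorm (u n.+1 - u n) <= r n.+1 - r n.
  elim: n => [|n IHn]; first by have := ur 1%N; rewrite !subr0.
  have -> : u n.+2 - u n.+1 =
      (2^-1 : R)%:C *: ((u n.+1 - u n) * (u n.+1 + u n)).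
    rewrite {1 2}/u /= -/u -scalerBr opprD addrACA subrr add0r.
    congr (_ *: _); rewrite mulrDr !mulrBl (uu n n.+1).
    by rewrite addrA subrK.
  have -> : r n.+2 - r n.+1 = 2^-1 * ((r n.+1 - r n) * (r n.+1 + r n)).
    by rewrite {1 2}/r /= -/r; ring.
  rewrite cnormZr ger0_norm ?invr_ge0 ?ler0n// ler_pM2l ?invr_gt0 ?ltr0n//.
  rewrite (le_trans (cnormM_le _ _))// ler_pM ?cnorm_ge0//.
  by rewrite (le_trans (cnormD_le _ _))// lerD.
have r1 n : r n <= 1 by have /andP[] := sqrt_bound_itv n.
have [v uv] := converges_telescope du r1.
have vE : v + v = x + v * v.
  have vE : v = (2^-1 : R)%:C *: (x + v * v).
    apply: converges_unique (converges_shift uv) _.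
    exact: convergesZ (convergesD (converges_cst x) (convergesM uv uv)).
  by rewrite {1 2}vE -scalerDr scale_half2.
exists v; split.
- apply/esym/(converges_unique uv).
  have su n : star (u n) = u n.
    elim: n => [|n IHn]; first by rewrite star0.
    by rewrite /= starZr starD starM sx -/u IHn.
  have -> : u = fun n => star (u n) by apply/funext => n; rewrite su.
  exact: converges_star uv.
- by apply: converges_cnorm_le uv _ => n; exact: le_trans (ur n) (r1 n).
- rewrite mulrBl mul1r mulrBr mulr1 opprB addrA addrAC.
  by rewrite -(addrA 1) -opprD vE opprD addrA subrK.
- by move=> k kx; apply: converges_commute uv _ => n; exact: sqrt_iter_commute.
Qed.

(** The condition is that the spectrum lies in the interval from [0] to [2 t],
expressed without mentioning the spectrum. *)
Definition pos h :=
  star h = h /\ exists t, 0 <= t /\ cnorm (t%:C%:A - h) <= t.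

Lemma pos_star h : pos h -> star h = h. Proof. by case. Qed.

Lemma scalarD r s : (r + s)%:C%:A = r%:C%:A + s%:C%:A :> U.
Proof. by rewrite rmorphD scalerDl. Qed.

Lemma scalarM r s : r%:C *: s%:C%:A = (r * s)%:C%:A :> U.
Proof. by rewrite scalerA rmorphM. Qed.

Lemma scaleKr r a : r != 0 -> r%:C *: (r^-1%:C *: a) = a.
Proof. by move=> r0; rewrite scalerA -rmorphM divff// scale1r. Qed.

Lemma posD h k : pos h -> pos k -> pos (h + k).
Proof.
move=> [sh [s [s0 hs]]] [sk [t [t0 kt]]]; split; first by rewrite starD sh sk.
exists (s + t); rewrite addr_ge0//; split=> //.
by rewrite scalarD opprD addrACA (le_trans (cnormD_le _ _))// lerD.
Qed.

Lemma posZ r h : 0 <= r -> pos h -> pos (r%:C *: h).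
Proof.
move=> r0 [sh [s [s0 hs]]]; split; first by rewrite starZr sh.
exists (r * s); rewrite mulr_ge0//; split=> //.
by rewrite -scalarM -scalerBr cnormZr ger0_norm// ler_wpM2l.
Qed.

Lemma pos_scalar r : 0 <= r -> pos (r%:C%:A).
Proof.
move=> r0; split; first exact: star_scalar.
by exists r; rewrite subrr cnorm0.
Qed.

Lemma pos0 : pos 0.
Proof. by have := pos_scalar (lexx 0); rewrite scale0r. Qed.

Lemma pos_scalarB k t : star k = k -> cnorm k <= t -> pos (t%:C%:A - k).
Proof.
move=> sk kt; split; first by rewrite starB star_scalar sk.
by exists t; rewrite (le_trans (cnorm_ge0 k) kt) opprB addrC subrK.
Qed.

(** After rescaling, [h = 1 - x] with [||x|| <= 1].  The root lies in the
bicommutant of [h], which is what later commutation arguments need. *)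
Lemma pos_sqrt h : pos h ->
  exists b, [/\ pos b, b * b = h & forall k, k * h = h * k -> k * b = b * k].
Proof.
move=> [sh [t [t0 ht]]]; move: t0; rewrite le_eqVlt => /predU1P[t0|t0].
  move: ht; rewrite -t0 scale0r sub0r cnormN => h0.
  have {h0} -> : h = 0 by apply: cnorm_eq0; apply/eqP; rewrite eq_le h0 cnorm_ge0.
  by exists 0; split=> [||k _]; rewrite ?(mulr0, mul0r)//; exact: pos0.
have tn0 : t != 0 by rewrite gt_eqF.
pose x := t^-1%:C *: (t%:C%:A - h).
have [| |y [sy y1 yE yC]] := @sqrt_one_sub x.
- by rewrite starZr starB star_scalar sh.
- rewrite cnormZr ger0_norm ?invr_ge0 ?(ltW t0)// -(ler_pM2l t0) mulrA divff//.
  by rewrite mul1r mulr1.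
exists ((Num.sqrt t)%:C *: (1 - y)); split.
- apply: posZ (sqrtr_ge0 _) _; rewrite -(scale1r 1).
  by apply: (@pos_scalarB y 1).
- rewrite -scalerAl -scalerAr scalerA -rmorphM -expr2 sqr_sqrtr ?ltW//.
  by rewrite yE scalerBr scaleKr// opprB addrC subrK.
- move=> k kh; apply/commuteZ/commuteB; first by rewrite mulr1 mul1r.
  by apply/yC/commuteZ/commuteB => //; exact: commute_scalar.
Qed.

(** The element [u := b + i c] satisfies [u^* u = b^2 + c^2 = r], so
[||u||^2 = r], and [b] is the mean of [u] and [u^*]. *)
Lemma cnorm_sqr_le b c r : star b = b -> star c = c -> b * c = c * b ->
  b * b + c * c = r%:C%:A -> 0 <= r -> cnorm (b * b) <= r.
Proof.
move=> sb sc bc bbcc r0; pose u := b + 'i *: c.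
have su : star u = b - 'i *: c.
  by rewrite starD sb starZ conjCi scaleNr sc.
have uu : star u * u = r%:C%:A.
  rewrite su mulrBl !mulrDr -!scalerAl -!scalerAr scalerA mulCii bc.
  by rewrite scaleN1r opprD opprK addrA addrK.
have bu : cnorm b <= cnorm u.
  have -> : b = (2^-1 : R)%:C *: (u + star u).
    by rewrite su addrACA subrr addr0 scale_half2.
  rewrite cnormZr ger0_norm ?invr_ge0 ?ler0n//.
  by have := cnormD_le u (star u); rewrite cnorm_star; lra.
rewrite cnorm_sqr// (_ : r = cnorm u ^+ 2) ?lerXn2r ?nnegrE ?cnorm_ge0//.
by rewrite -cnorm_starM uu cnorm_scalar ger0_norm.
Qed.

(** Since [||b^2|| <= s], the element [s - b^2] has a square root [c], which
commutes with [b]; then [c^2 + b^2 = s]. *)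
Lemma cnorm_gauge_sqr b s : star b = b -> cnorm (b * b) <= s ->
  cnorm (s%:C%:A - b * b) <= s.
Proof.
move=> sb bs; have sbb : star (b * b) = b * b by rewrite starM sb.
have [c [cpos cc cC]] := pos_sqrt (pos_scalarB sbb bs).
rewrite -cc; apply: (@cnorm_sqr_le c b) => //.
- exact: pos_star.
- apply/esym; apply: cC; apply: commuteB; first exact: commute_scalar.
  by rewrite mulrA.
- by rewrite cc subrK.
- exact: le_trans (cnorm_ge0 _) bs.
Qed.

Lemma pos_sqr b : star b = b -> pos (b * b).
Proof.
move=> sb; split; first by rewrite starM sb.
by exists (cnorm (b * b)); rewrite cnorm_ge0 cnorm_gauge_sqr.
Qed.

(** In the definition of [pos], any [t >= ||h||] can be taken: the condition is
then uniform enough to pass to limits. *)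
Lemma pos_gauge h s : pos h -> cnorm h <= s -> cnorm (s%:C%:A - h) <= s.
Proof.
by move=> /pos_sqrt[b [/pos_star sb <- _]]; exact: cnorm_gauge_sqr.
Qed.

Lemma pos_closed h : star h = h -> (forall e, 0 < e -> pos (h + e%:C%:A)) ->
  pos h.
Proof.
move=> sh he; split=> //; exists (cnorm h); split; first exact: cnorm_ge0.
apply/ler_addgt0Pr => e e0; have := pos_gauge (he e e0).
move/(_ (cnorm h + e)); rewrite scalarD opprD addrACA subrr addr0; apply.
rewrite (le_trans (cnormD_le _ _))// cnorm_scalar lerD2l ger0_norm// ltW//.
Qed.

(** With [t := ||k||], both [h] and [t - h = (t - k) + (k - h)] are positive;
their square roots commute and have squares summing to [t]. *)
Lemma pos_cnorm_le h k : pos h -> pos (k - h) -> cnorm h <= cnorm k.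
Proof.
move=> hpos khpos; set t := cnorm k.
have sk : star k = k by rewrite -(subrK h k) starD !pos_star.
have thpos : pos (t%:C%:A - h).
  by rewrite -(subrKA k); apply: posD khpos; exact: pos_scalarB.
have [b [bpos bb bC]] := pos_sqrt hpos.
have [c [cpos cc cC]] := pos_sqrt thpos.
rewrite -bb; apply: (@cnorm_sqr_le b c).
- exact: pos_star.
- exact: pos_star.
- apply: cC; apply: commuteB; first exact: commute_scalar.
  by rewrite -bb mulrA.
- by rewrite bb cc addrC subrK.
- exact: cnorm_ge0.
Qed.

Lemma pos_eq0 h : pos h -> pos (- h) -> h = 0.
Proof.
move=> hpos; rewrite -sub0r => /(pos_cnorm_le hpos); rewrite cnorm0 => h0.
by apply: cnorm_eq0; apply/eqP; rewrite eq_le h0 cnorm_ge0.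
Qed.

(** Here [h + s = (t + s) (1 - x)] with [||x|| <= t / (t + s) < 1]. *)
Lemma pos_invertible h s : pos h -> 0 < s -> invertible (h + s%:C%:A).
Proof.
move=> [sh [t [t0 ht]]] s0; have ts0 : 0 < t + s by rewrite ltr_wpDl.
have tsn0 : t + s != 0 by rewrite gt_eqF.
have -> : h + s%:C%:A =
    (t + s)%:C *: (1 - (t + s)^-1%:C *: (t%:C%:A - h)).
  by rewrite scalerBr scaleKr// opprB (addrC _ (h - _)) scalarD addrA subrK.
apply: invertibleZ => //; apply: neumann.
rewrite cnormZr ger0_norm ?invr_ge0 ?(ltW ts0)//.
by rewrite mulrC ltr_pdivrMr// mul1r (le_lt_trans ht)// ltrDl.
Qed.

(** Write [c = b^2] with inverse [d].  For [e] small, [1/e - d] has a square root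
[f], and [c - e = e b (1/e - d) b = e (b f)^2]. *)
Lemma pos_open (c : U) : pos c -> invertible c ->
  exists2 e : R, 0 < e & pos (c - e%:C%:A).
Proof.
move=> cpos [d [cd dc]]; have [b [bpos bb bC]] := pos_sqrt cpos.
have sc := pos_star cpos; have sb := pos_star bpos.
have sd : star d = d.
  by rewrite -[LHS]mulr1 -cd mulrA -{1}sc -starM cd star1 mul1r.
have bd : b * d = d * b.
  have bc : b * c = c * b by rewrite -bb mulrA.
  by rewrite -[b * d]mul1r -dc -mulrA (mulrA c) -bc -mulrA cd mulr1.
have [e e0 de] : exists2 e, 0 < e & cnorm d <= e^-1.
  exists (cnorm d + 1)^-1; first by rewrite invr_gt0 ltr_wpDl ?cnorm_ge0.
  by rewrite invrK lerDl.
exists e => //.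
have [f [fpos ff fC]] := pos_sqrt (pos_scalarB sd de).
have bf : b * f = f * b.
  by apply: fC; apply: commuteB => //; exact: commute_scalar.
have -> : c - e%:C%:A = e%:C *: ((b * f) * (b * f)).
  rewrite {2}bf mulrA -(mulrA b f f) ff mulrBr mulrBl -scalerAr mulr1 -scalerAl.
  by rewrite bb bd -mulrA bb dc scalerBr scaleKr// gt_eqF.
apply: posZ (ltW e0) _; apply: pos_sqr.
by rewrite starM (pos_star fpos) sb bf.
Qed.

(** Let [m] be the infimum of the [t > 0] with [h + t] positive.  By closedness
[h + m] is positive; if [m] were positive, [h + m] would be invertible and
[pos_open] would produce a smaller such [t]. *)
Lemma pos_resolvent h : star h = h ->
  (forall s, 0 < s -> invertible (h + s%:C%:A)) -> pos h.
Proof.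
move=> sh hinv; pose E : set R := [set t | 0 < t /\ pos (h + t%:C%:A)].
have Eup t s : E t -> t <= s -> E s.
  move=> [t0 tpos] ts; split; first exact: lt_le_trans ts.
  rewrite -(subrK t s) (addrC (s - t)) scalarD addrA.
  by apply: posD tpos _; apply: pos_scalar; rewrite subr_ge0.
have EN : E (cnorm h + 1).
  split; first by rewrite ltr_wpDl ?cnorm_ge0.
  rewrite -[h]opprK addrC cnormN; apply: pos_scalarB.
    by rewrite starN sh.
  by rewrite cnormN lerDl.
have Elb : has_lbound E by exists 0 => t [/ltW].
have Einf : has_inf E by split => //; exists (cnorm h + 1).
set m := inf E.
have m0 : 0 <= m by apply: lb_le_inf => [|t [/ltW]//]; exists (cnorm h + 1).
have above e : 0 < e -> E (m + e).
  move=> e0; have [t Et tm] := inf_adherent e0 Einf.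
  exact: Eup Et (ltW tm).
have mpos : pos (h + m%:C%:A).
  apply: pos_closed; first by rewrite starD sh star_scalar.
  by move=> e e0; rewrite -addrA -scalarD; have [] := above e e0.
move: m0; rewrite le_eqVlt => /predU1P[m0|m0].
  by move: mpos; rewrite -m0 scale0r addr0.
have [e e0 epos] := pos_open mpos (hinv m m0).
pose d := Num.min e (m / 2).
have d0 : 0 < d by rewrite lt_min e0 divr_gt0.
have : E (m - d).
  split; first by rewrite subr_gt0 gt_min; apply/orP; right; lra.
  have -> : h + (m - d)%:C%:A = h + m%:C%:A - e%:C%:A + (e - d)%:C%:A.
    rewrite (_ : m - d = m + (- e + (e - d))); last by ring.
    by rewrite !(scalarD, rmorphN, scaleNr) !addrA.
  by apply: posD epos _; apply: pos_scalar; rewrite subr_ge0 ge_min lexx.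
move/(ge_inf Elb); rewrite -/m; lra.
Qed.

Lemma sqr_polar a b :
  (a + b) * (a + b) - (a - b) * (a - b) = (a * b + b * a) + (a * b + b * a).
Proof.
rewrite mulrDr mulrBr opprB (addrC (_ * b) (- _)) addrACA -mulrBl -mulrDl.
rewrite opprB (addrC a b) addrACA subrr addr0 (addrC b a).
by rewrite addrACA subrr addr0 !mulrDl addrACA !(addrC (b * a)).
Qed.

Lemma star_star_mul v : star (star v * v) = star v * v.
Proof. by rewrite starM starK. Qed.

(** With [w = a + i b], one has [w^* w + w w^* = 2 (a^2 + b^2)], so [w w^*] is
positive.  As [w^* w + s] is invertible whenever [w w^* + s] is, [w^* w] is
positive too; being also negative it vanishes. *)
Lemma pos_oppr_starM_eq0 w : pos (- (star w * w)) -> w = 0.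
Proof.
move=> npos; pose p := w + star w; pose q := 'i *: (w - star w).
have sp : star p = p by rewrite starD starK addrC.
have sq : star q = q.
  by rewrite starZ conjCi starB starK scaleNr -scalerN opprB.
have mE : w * star w = (2^-1 : R)%:C *: (p * p + q * q) + - (star w * w).
  apply/esym/eqP; rewrite subr_eq; apply/eqP.
  rewrite -[RHS]scale_half2; congr (_ *: _).
  rewrite -scalerAl -scalerAr scalerA mulCii scaleN1r.
  exact: sqr_polar.
have mpos : pos (w * star w).
  rewrite mE; apply: posD npos; apply: posZ; first by rewrite invr_ge0 ler0n.
  by apply: posD; apply: pos_sqr.
have wpos : pos (star w * w).
  apply: pos_resolvent => [|s s0]; first exact: star_star_mul.
  have [d [md dm]] := pos_invertible mpos s0.
  have sn0 : s != 0 by rewrite gt_eqF.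
  have ss : (s%:C : R[i]) * s^-1%:C = 1 by rewrite -rmorphM divff.
  (* [1 - w^* (w w^* + s)^-1 w] inverts [w^* w + s] up to the factor [s]. *)
  exists (s^-1%:C *: (1 - star w * d * w)).
  rewrite -scalerAr -scalerAl.
  have E1 : (star w * w + s%:C%:A) * (star w * d * w) = star w * w.
    rewrite mulrDl mulr_algl -!mulrA (mulrA w) (mulrA (w * star w)).
    by rewrite scalerAr -mulrDr scalerAl -mulrDl -mulr_algl -mulrDl md mul1r.
  have E2 : (star w * d * w) * (star w * w + s%:C%:A) = star w * w.
    rewrite mulrDr mulr_algr -!mulrA (mulrA w) (mulrA d).
    by rewrite scalerAr scalerAl -mulrDr -mulrDl -mulr_algr -mulrDr dm mul1r.
  rewrite mulrBr mulrBl mulr1 mul1r E1 E2 addrC addKr.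
  by rewrite scalerA mulrC ss scale1r.
have := pos_eq0 wpos npos => ww0; apply: cnorm_eq0; apply/eqP.
by rewrite -sqrf_eq0 -cnorm_starM ww0 cnorm0.
Qed.

(** Let [c := v^* v], let [p] be the square root of [c^2], and [f := p - c], which
is twice the negative part of [c].  Then [c f = - p f], so [v f] satisfies
[(v f)^* (v f) = - f p f <= 0] and therefore vanishes.  Hence [c f = p f = 0],
[f^2 = 0] and [c = p]. *)
Lemma pos_starM v : pos (star v * v).
Proof.
set c := star v * v; have sc : star c = c := star_star_mul v.
have [p [ppos pp pC]] := pos_sqrt (pos_sqr sc).
have cp : c * p = p * c by apply: pC; rewrite mulrA.
have [q [qpos qq qC]] := pos_sqrt ppos.
have cq : c * q = q * c by apply: qC.
have pq : p * q = q * p by apply: qC.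
have sp := pos_star ppos; have sq := pos_star qpos.
pose f := p - c; have sf : star f = f by rewrite starB sp sc.
have fq : f * q = q * f by apply/esym/commuteB.
have cf : c * f = - (p * f) by rewrite !mulrBr pp cp opprB.
have vf0 : v * f = 0.
  apply: pos_oppr_starM_eq0.
  rewrite starM sf -mulrA (mulrA (star v)) -/c cf mulrN opprK.
  rewrite -qq !mulrA fq -mulrA.
  apply: pos_sqr.
  by rewrite starM sq sf.
have ff0 : f * f = 0.
  have cf0 : c * f = 0 by rewrite /c -mulrA vf0 mulr0.
  by rewrite {1}/f mulrBl -[p * f]opprK -cf cf0 oppr0 addr0.
have : f = 0 by apply: sqr_eq0.
by move/eqP; rewrite subr_eq0 => /eqP <-.
Qed.

Lemma pos_conj h a : pos h -> pos (star a * h * a).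
Proof.
move=> /pos_sqrt[b [/pos_star sb <- _]].
by have := pos_starM (b * a); rewrite starM sb !mulrA.
Qed.

Lemma invertible_factor a b : a * b = b * a -> invertible (a * b) ->
  invertible a.
Proof.
move=> ab [d [abd dab]]; exists (b * d); split; first by rewrite mulrA.
have -> : b * d = d * b.
  by rewrite -[b * d]mul1r -dab ab -!mulrA (mulrA a) abd mulr1.
by rewrite -mulrA -ab dab.
Qed.

(** For [l = x + i y] with [y] nonzero and [k := h - x], the product
[(k - i y) (k + i y) = k^2 + y^2] is invertible, [k^2] being positive. *)
Lemma pos_spectrum h (l : R[i]) : pos h -> ~ (0 <= l) -> invertible (h - l%:A).
Proof.
move=> hpos lN; set x := complex.Re l; set y := complex.Im l.
have lE : l = x%:C + 'i * y%:C by rewrite [LHS]complexE complexiE.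
have [y0|y0] := eqVneq y 0.
  rewrite lE y0 mulr0 addr0 -scaleNr -rmorphN; apply: pos_invertible => //.
  rewrite oppr_gt0 ltNge; apply/negP => x0; apply: lN.
  by rewrite lE y0 mulr0 addr0 lecR.
set z : R[i] := 'i * y%:C.
have [k sk ->] : exists2 k, star k = k & h - l%:A = k - z%:A.
  exists (h - x%:C%:A); first by rewrite starB star_scalar (pos_star hpos).
  by rewrite lE scalerDl opprD addrA.
apply: (@invertible_factor _ (k + z%:A)).
  by apply: commuteD; [apply/esym/commuteB => //; exact: commute_scalar
                      | exact: commute_scalar].
have -> : (k - z%:A) * (k + z%:A) = k * k + (y ^+ 2)%:C%:A.
  have zz : z%:A * z%:A = (z * z)%:A :> U by rewrite mulr_algl scalerA.
  rewrite mulrDr !mulrBl zz (commute_scalar z k) addrA subrK -scaleNr.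
  congr (_ + _ *: _).
  by rewrite /z mulrACA mulCii mulN1r opprK rmorphXn.
by apply: pos_invertible; [exact: pos_sqr | rewrite exprn_even_gt0].
Qed.

(** With [n := ||g||] nonzero, the element multiplied by [n] equals
[(n a - g b)^* (n a - g b) + b^* (n^2 - g^* g) b]. *)
Lemma pos_cross a b g :
  pos ((cnorm g)%:C *: (star a * a + star b * b) -
       (star a * g * b + star b * star g * a)).
Proof.
set n := cnorm g; have [n0|n0] := eqVneq n 0.
  by rewrite (cnorm_eq0 _ n0) n0 star0 !(mulr0, mul0r) addr0 scale0r subr0; exact: pos0.
have np : 0 < n by rewrite lt_neqAle eq_sym n0 cnorm_ge0.
pose x := n%:C *: a - g * b.
have gpos : pos ((n ^+ 2)%:C%:A - star g * g).
  by apply: pos_scalarB; [exact: star_star_mul | rewrite cnorm_starM].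
have := posD (pos_starM x) (pos_conj b gpos).
have -> : star x * x + star b * ((n ^+ 2)%:C%:A - star g * g) * b =
   n%:C *: (n%:C *: (star a * a + star b * b) -
       (star a * g * b + star b * star g * a)).
  have -> : star b * ((n ^+ 2)%:C%:A - star g * g) * b =
      n%:C *: (n%:C *: (star b * b)) - star b * star g * g * b.
    by rewrite mulrBr mulrBl mulr_algr -scalerAl !mulrA scalerA -rmorphM.
  have -> : star x * x = n%:C *: (n%:C *: (star a * a))
      - n%:C *: (star a * g * b) - n%:C *: (star b * star g * a)
      + star b * star g * g * b.
    rewrite /x starB starZr starM mulrBr !mulrBl.
    rewrite -!scalerAl -!scalerAr opprB !mulrA [X in _ + X]addrC addrA.
    by congr (_ + _); rewrite addrAC.
  rewrite addrACA subrr addr0 -(addrA (_ *: _)) -opprD addrAC.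
  by rewrite scalerBr !scalerDr.
move/(posZ (r := n^-1)); rewrite scalerA -rmorphM mulVf// scale1r; apply.
by rewrite invr_ge0 ltW.
Qed.

End Positive.

(** * The unitization *)

Section SeqComplete.
Variables (K : numFieldType) (V : completeNormedModType K).

Lemma seq_complete (u : nat -> V) :
  (forall e : K, 0 < e -> exists N : nat, forall m n : nat,
     (N <= m)%N -> (N <= n)%N -> `|u m - u n| < e) ->
  exists v : V, forall e : K, 0 < e -> exists N : nat, forall n : nat,
     (N <= n)%N -> `|u n - v| < e.
Proof.
move=> uC; have : cvg (u @ \oo).
  apply: cauchy_cvg; apply/cauchy_ballP => e e0.
  have [N uN] := uC e e0.
  pose T := [set x | exists2 n, (N <= n)%N & x = u n].
  exists (T, T); first by split; exists N => // n Nn; exists n.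
  move=> [x y] [[m Nm ->] [n Nn ->]] /=.
  by rewrite -ball_normE; exact: uN.
move=> /cvg_ex[v uv]; exists v => e e0.
move/cvgrPdist_lt : uv => /(_ e e0)[N _ uN].
by exists N => n Nn; rewrite distrC; exact: uN.
Qed.

End SeqComplete.

Section RealNorm.
Variables (R : realType) (A : cstarAlgType R).
Implicit Types (a b c : A) (l : R[i]) (r : R).

Definition rmod l : R := complex.Re `|l|.
Definition rnorm a : R := complex.Re `|a|.

Lemma rmodE l : (rmod l)%:C = `|l|.
Proof. exact: ReNormK. Qed.

Lemma rnormE a : (rnorm a)%:C = `|a|.
Proof. by rewrite RRe_real// normr_real. Qed.

Lemma rnorm_ge0 a : 0 <= rnorm a.
Proof. by rewrite -(lecR 0) rnormE normr_ge0. Qed.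

Lemma rmod_ge0 l : 0 <= rmod l.
Proof. by rewrite -(lecR 0) rmodE normr_ge0. Qed.

Lemma rnorm0 : rnorm (0 : A) = 0.
Proof. by rewrite /rnorm normr0. Qed.

Lemma rmod0 : rmod 0 = 0.
Proof. by rewrite /rmod normr0. Qed.

Lemma rmodM l m : rmod (l * m) = rmod l * rmod m.
Proof. by apply: complexI; rewrite rmorphM !rmodE normrM. Qed.

Lemma rmodJ l : rmod l^* = rmod l.
Proof. by rewrite /rmod norm_conjC. Qed.

Lemma rmodD l m : rmod (l + m) <= rmod l + rmod m.
Proof. by rewrite -lecR rmorphD !rmodE ler_normD. Qed.

Lemma rnormD a b : rnorm (a + b) <= rnorm a + rnorm b.
Proof. by rewrite -lecR rmorphD /= !rnormE ler_normD. Qed.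

Lemma rnormZ l a : rnorm (l *: a) = rmod l * rnorm a.
Proof. by apply: complexI; rewrite rmorphM /= !rnormE rmodE normrZ. Qed.

Lemma rnorm_eq0 a : rnorm a = 0 -> a = 0.
Proof. by move=> a0; apply: normr0_eq0; rewrite -rnormE a0. Qed.

Lemma rmod_eq0 l : rmod l = 0 -> l = 0.
Proof. by move=> a0; apply: normr0_eq0; rewrite -rmodE a0. Qed.

Lemma rnormM a b : rnorm (amul a b) <= rnorm a * rnorm b.
Proof. by rewrite -lecR rmorphM /= !rnormE norm_amul. Qed.

Lemma rnorm_starM a : rnorm (amul (astar a) a) = rnorm a ^+ 2.
Proof. by apply: complexI; rewrite rmorphXn /= !rnormE norm_astar_amul. Qed.

Lemma rnorm_star a : rnorm (astar a) = rnorm a.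
Proof.
suff le (x : A) : rnorm x <= rnorm (astar x).
  by apply/eqP; rewrite eq_le le andbT -{2}(astarK a) le.
have [->|x0] := eqVneq (rnorm x) 0; first exact: rnorm_ge0.
have xp : 0 < rnorm x by rewrite lt_neqAle eq_sym x0 rnorm_ge0.
by rewrite -(ler_pM2r xp) -expr2 -rnorm_starM rnormM.
Qed.

Lemma amul0l a : amul 0 a = 0 :> A.
Proof. by have := amulZl 0 0 a; rewrite !scale0r. Qed.

Lemma amul0r a : amul a 0 = 0 :> A.
Proof. by have := amulZr 0 a 0; rewrite !scale0r. Qed.

Lemma astar0 : astar (0 : A) = 0.
Proof. by have := astarZ 0 (0 : A); rewrite conjC0 !scale0r. Qed.

Lemma astarB a b : astar (a - b) = astar a - astar b.
Proof. by rewrite -scaleN1r astarD astarZ rmorphN1 scaleN1r. Qed.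

End RealNorm.

(** An alias of the product type, which carries the multiplication of the
unitization instead of the componentwise one. *)
Definition unitz (R : realType) (A : cstarAlgType R) : Type := (A * R[i])%type.

Section UnitzRing.
Variables (R : realType) (A : cstarAlgType R).
Local Notation U := (unitz A).

HB.instance Definition _ := GRing.Lmodule.copy U (A * R[i])%type.

Lemma unitz_mulA : associative (@unitz_mul R A).
Proof.
move=> [a l] [b m] [c n]; rewrite /unitz_mul /=; congr pair; last exact: mulrA.
rewrite !(amulDl, amulDr, scalerDr, amulZl, amulZr, amulA, scalerA) -!addrA.
congr (_ + _).
rewrite (mulrC n l) (mulrC n m).
rewrite (addrCA (n *: amul a b) (l *: _)) (addrCA (m *: _)).
by congr (_ + (_ + _)); exact: addrCA.
Qed.

Lemma unitz_mul1l : left_id (@unitz_one R A) (@unitz_mul R A).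
Proof.
by move=> [a l]; rewrite /unitz_mul /= amul0l add0r scale1r scaler0 addr0 mul1r.
Qed.

Lemma unitz_mul1r : right_id (@unitz_one R A) (@unitz_mul R A).
Proof.
by move=> [a l]; rewrite /unitz_mul /= amul0r add0r scale1r scaler0 add0r mulr1.
Qed.

Lemma unitz_mulDl : left_distributive (@unitz_mul R A) +%R.
Proof.
move=> [a l] [b m] [c n]; rewrite /unitz_mul /=; congr pair; last exact: mulrDl.
rewrite amulDl scalerDl scalerDr /= -!addrA; congr (_ + _).
by rewrite addrCA; congr (_ + _); rewrite (addrCA (m *: _)); exact: addrCA.
Qed.

Lemma unitz_mulDr : right_distributive (@unitz_mul R A) +%R.
Proof.
move=> [a l] [b m] [c n]; rewrite /unitz_mul /=; congr pair; last exact: mulrDr.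
rewrite amulDr scalerDl scalerDr /= -!addrA; congr (_ + _).
by rewrite addrCA; congr (_ + _); rewrite (addrCA (l *: _)); exact: addrCA.
Qed.

Lemma unitz_one_neq0 : @unitz_one R A != 0.
Proof. by apply/eqP => -[] /eqP; rewrite oner_eq0. Qed.

HB.instance Definition _ := GRing.Zmodule_isNzRing.Build U
  unitz_mulA unitz_mul1l unitz_mul1r unitz_mulDl unitz_mulDr unitz_one_neq0.

Lemma unitz_scalerAl (k : R[i]) (u v : U) : k *: (u * v) = (k *: u) * v.
Proof.
case: u v => [a l] [b m]; congr pair; last exact: mulrA.
by rewrite /= !scalerDr amulZl !scalerA (mulrC k m).
Qed.

HB.instance Definition _ := GRing.Lmodule_isLalgebra.Build R[i] U unitz_scalerAl.

Lemma unitz_scalerAr (k : R[i]) (u v : U) : k *: (u * v) = u * (k *: v).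
Proof.
case: u v => [a l] [b m]; congr pair; last exact: mulrCA.
by rewrite /= !scalerDr amulZr !scalerA (mulrC k l).
Qed.

HB.instance Definition _ := GRing.Lalgebra_isAlgebra.Build R[i] U unitz_scalerAr.

End UnitzRing.

Section UnitzNorm.
Variables (R : realType) (A : cstarAlgType R).
Local Notation U := (unitz A).
Implicit Types (u v : U) (a b x : A) (l : R[i]) (r s : R).

Definition lact u b : A := amul u.1 b + u.2 *: b.

Definition unitz_star u : U := (astar u.1, u.2^*).

Definition lact_ball u : set R :=
  [set rnorm (lact u b) | b in [set b | rnorm b <= 1]].

(** The first term, the norm of the left multiplication by [u] on [A], is only a
seminorm when [A] has a unit, since the unit of [A] minus that of the
unitization then acts as [0]; the second term, the modulus of a character, detects
these remaining elements. *)
Definition unitz_norm u : R := Num.max (sup (lact_ball u)) (rmod u.2).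

Lemma lactZr l u b : lact u (l *: b) = l *: lact u b.
Proof. by rewrite /lact amulZr scalerDr !scalerA mulrC. Qed.

Lemma lactM u v b : lact (u * v) b = lact u (lact v b).
Proof.
case: u v => [a l] [c m]; rewrite /lact /= !(amulDl, amulDr, scalerDr) amulZl amulZr.
rewrite amulA amulZl scalerA -!addrA; congr (_ + _).
by rewrite addrCA; congr (_ + _); rewrite addrA.
Qed.

Lemma lactD u v b : lact (u + v) b = lact u b + lact v b.
Proof. by rewrite /lact amulDl scalerDl addrACA. Qed.

Lemma lactZ l u b : lact (l *: u) b = l *: lact u b.
Proof. by rewrite /lact amulZl scalerDr !scalerA. Qed.

Lemma lact_adj u b x :
  amul (astar (lact u b)) x = amul (astar b) (lact (unitz_star u) x).
Proof.
by rewrite /lact astarD astarM astarZ amulDl amulZl amulDr amulZr amulA.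
Qed.

Lemma lact_bound u b : rnorm (lact u b) <= (rnorm u.1 + rmod u.2) * rnorm b.
Proof.
by rewrite (le_trans (rnormD _ _))// mulrDl rnormZ lerD// rnormM.
Qed.

Lemma lact_ball_sup u : has_sup (lact_ball u).
Proof.
split; first by exists (rnorm (lact u 0)), 0 => //=; rewrite rnorm0.
exists (rnorm u.1 + rmod u.2) => _ [b b1 <-].
rewrite (le_trans (lact_bound _ _))// -[leRHS]mulr1 ler_wpM2l//.
by rewrite addr_ge0 ?rnorm_ge0 ?rmod_ge0.
Qed.

Lemma lact_le u b : rnorm (lact u b) <= unitz_norm u * rnorm b.
Proof.
have [b0|b0] := eqVneq (rnorm b) 0.
  by rewrite (rnorm_eq0 b0) -(scale0r (0 : A)) lactZr !scale0r rnorm0 mulr0.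
have bp : 0 < rnorm b by rewrite lt_neqAle eq_sym b0 rnorm_ge0.
have rV : rmod (rnorm b)^-1%:C = (rnorm b)^-1.
  by rewrite /rmod normc_real ger0_norm// invr_ge0 ltW.
rewrite -ler_pdivrMr// mulrC -rV -rnormZ -lactZr le_max; apply/orP; left.
apply: ub_le_sup; first by have [] := lact_ball_sup u.
by eexists; last reflexivity; rewrite /= rnormZ rV mulVf.
Qed.

Lemma rmod_le u : rmod u.2 <= unitz_norm u.
Proof. by rewrite le_max lexx orbT. Qed.

Lemma unitz_norm_ge0 u : 0 <= unitz_norm u.
Proof. exact: le_trans (rmod_ge0 _) (rmod_le u). Qed.

Lemma unitz_norm_le u r : rmod u.2 <= r ->
  (forall b, rnorm (lact u b) <= r * rnorm b) -> unitz_norm u <= r.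
Proof.
move=> ur lr; rewrite ge_max ur andbT; apply: ge_sup.
  by have [] := lact_ball_sup u.
move=> _ [b b1 <-]; rewrite (le_trans (lr b))// -[leRHS]mulr1 ler_wpM2l//.
exact: le_trans (rmod_ge0 _) ur.
Qed.

Lemma unitz_starK : involutive unitz_star.
Proof. by case=> a l; rewrite /unitz_star /= astarK conjCK. Qed.

Lemma unitz_starD : {morph unitz_star : u v / u + v}.
Proof. by move=> [a l] [b m]; rewrite /unitz_star /= astarD rmorphD. Qed.

Lemma unitz_starZ l u : unitz_star (l *: u) = l^* *: unitz_star u.
Proof. by case: u => a m; congr pair; rewrite /= ?astarZ ?rmorphM. Qed.

Lemma unitz_starM u v : unitz_star (u * v) = unitz_star v * unitz_star u.
Proof.
case: u v => [a l] [b m]; rewrite /unitz_star /=; congr pair.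
  by rewrite /= !astarD !astarZ astarM addrAC.
by rewrite rmorphM mulrC.
Qed.

Lemma unitz_normD u v : unitz_norm (u + v) <= unitz_norm u + unitz_norm v.
Proof.
apply: unitz_norm_le => [|b].
  by rewrite (le_trans (rmodD _ _))// lerD ?rmod_le.
by rewrite lactD (le_trans (rnormD _ _))// mulrDl lerD ?lact_le.
Qed.

Lemma unitz_normM u v : unitz_norm (u * v) <= unitz_norm u * unitz_norm v.
Proof.
apply: unitz_norm_le => [|b].
  by rewrite rmodM ler_pM ?rmod_ge0 ?rmod_le.
rewrite lactM (le_trans (lact_le _ _))// -mulrA ler_wpM2l ?unitz_norm_ge0//.
exact: lact_le.
Qed.

Lemma unitz_normZ l u : unitz_norm (l *: u) = rmod l * unitz_norm u.
Proof.
have le m v : unitz_norm (m *: v) <= rmod m * unitz_norm v.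
  apply: unitz_norm_le => [|b].
    by rewrite rmodM ler_wpM2l ?rmod_ge0 ?rmod_le.
  by rewrite lactZ rnormZ -mulrA ler_wpM2l ?rmod_ge0 ?lact_le.
apply/eqP; rewrite eq_le le /=.
have [->|l0] := eqVneq l 0; first by rewrite rmod0 mul0r unitz_norm_ge0.
have lV : rmod l * rmod l^-1 = 1 by rewrite -rmodM divff// /rmod normr1.
have := le l^-1 (l *: u); rewrite scalerA mulVf// scale1r.
by move/(ler_wpM2l (rmod_ge0 l)); rewrite mulrA lV mul1r.
Qed.

Lemma unitz_norm_eq0 u : unitz_norm u = 0 -> u = 0.
Proof.
move=> u0; have l0 : u.2 = 0.
  apply: rmod_eq0; apply/eqP; rewrite eq_le rmod_ge0 andbT -u0; exact: rmod_le.
have a0 : astar u.1 = 0.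
  apply: rnorm_eq0; apply/eqP; rewrite -sqrf_eq0 -rnorm_starM astarK.
  have := lact_le u (astar u.1).
  by rewrite u0 mul0r /lact l0 scale0r addr0 => h; rewrite eq_le h rnorm_ge0.
by case: u l0 a0 {u0} => a l /= -> a0; rewrite -(astarK a) a0 astar0.
Qed.

(** For the operator part,
[||u b||^2 = ||b^* (u^* u b)|| <= ||u^* u|| ||b||^2]. *)
Lemma unitz_norm_starM u : unitz_norm (unitz_star u * u) = unitz_norm u ^+ 2.
Proof.
have sqr_le v : unitz_norm v ^+ 2 <= unitz_norm (unitz_star v * v).
  set n := unitz_norm (_ * v); have n0 : 0 <= n := unitz_norm_ge0 _.
  rewrite -[leRHS]sqr_sqrtr// lerXn2r ?nnegrE ?unitz_norm_ge0 ?sqrtr_ge0//.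
  apply: unitz_norm_le => [|b].
    rewrite -(@ler_pXn2r _ 2) ?nnegrE ?rmod_ge0 ?sqrtr_ge0// sqr_sqrtr//.
    by have := rmod_le (unitz_star v * v); rewrite /= rmodM rmodJ.
  rewrite -(@ler_pXn2r _ 2) ?nnegrE ?rnorm_ge0 ?mulr_ge0 ?rnorm_ge0 ?sqrtr_ge0//.
  rewrite exprMn sqr_sqrtr// -rnorm_starM lact_adj -lactM.
  rewrite (le_trans (rnormM _ _))// rnorm_star expr2 mulrA [leRHS]mulrC.
  rewrite ler_wpM2l ?rnorm_ge0//.
  exact: lact_le.
have star_le v : unitz_norm v <= unitz_norm (unitz_star v).
  have [->|v0] := eqVneq (unitz_norm v) 0; first exact: unitz_norm_ge0.
  have vp : 0 < unitz_norm v by rewrite lt_neqAle eq_sym v0 unitz_norm_ge0.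
  by rewrite -(ler_pM2r vp) -expr2 (le_trans (sqr_le v))// unitz_normM.
apply/eqP; rewrite eq_le sqr_le andbT (le_trans (unitz_normM _ _))//.
rewrite expr2 ler_wpM2r ?unitz_norm_ge0//.
by rewrite -{2}(unitz_starK u) star_le.
Qed.

(** Testing the left multiplication by [a] on [a^*] attains the norm of [a]. *)
Lemma unitz_norm_inl a : unitz_norm (a, 0) = rnorm a.
Proof.
apply/eqP; rewrite eq_le; apply/andP; split.
  apply: unitz_norm_le => [|b]; first by rewrite rmod0 rnorm_ge0.
  by rewrite /lact /= scale0r addr0 rnormM.
have [a0|a0] := eqVneq (rnorm a) 0; first by rewrite a0 unitz_norm_ge0.
have ap : 0 < rnorm a by rewrite lt_neqAle eq_sym a0 rnorm_ge0.
have := lact_le (a, 0) (astar a); rewrite /lact /= scale0r addr0.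
by rewrite -{1}(astarK a) rnorm_starM rnorm_star expr2 ler_pM2r.
Qed.

Lemma unitz_norm_inr l : unitz_norm (0, l) <= rmod l.
Proof.
by apply: unitz_norm_le => //= b; rewrite /lact /= amul0l add0r rnormZ.
Qed.

Lemma unitz_splitE u : u = ((u.1, 0) : U) + ((0, u.2) : U).
Proof. by case: u => a l; congr pair; rewrite /= ?addr0 ?add0r. Qed.

Lemma unitz_norm_split u : unitz_norm u <= rnorm u.1 + rmod u.2.
Proof.
rewrite {1}(unitz_splitE u) (le_trans (unitz_normD _ _))// unitz_norm_inl.
by rewrite lerD2l unitz_norm_inr.
Qed.

Lemma rnorm_le_unitz_norm u : rnorm u.1 <= 2 * unitz_norm u.
Proof.
rewrite -unitz_norm_inl.
have -> : ((u.1, 0) : U) = u + -1 *: ((0, u.2) : U).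
  by rewrite scaleN1r {2}(unitz_splitE u) addrK.
rewrite (le_trans (unitz_normD _ _))// unitz_normZ.
have -> : rmod (-1 : R[i]) = 1 by rewrite /rmod normrN1.
rewrite mul1r mulr2n mulrDl mul1r lerD2l.
exact: le_trans (unitz_norm_inr _) (rmod_le _).
Qed.

Lemma rmod_Im l : `|complex.Im l| <= rmod l.
Proof.
have -> : rmod l = rmod (l * 'i%C) by rewrite rmodM complexiE /rmod normCi mulr1.
by rewrite -normrN -ReiNIm -lecR rmodE normc_ge_Re.
Qed.

Lemma rmod_Re_Im l : rmod l <= `|complex.Re l| + `|complex.Im l|.
Proof.
rewrite {1}(complexE l) (le_trans (rmodD _ _))// rmodM complexiE.
by rewrite /rmod !normc_real normCi mul1r.
Qed.

Lemma unitz_complete (u : nat -> U) :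
  (forall e : R, 0 < e -> exists N : nat, forall m n : nat,
    (N <= m)%N -> (N <= n)%N -> unitz_norm (u m - u n) < e) ->
  exists v : U, forall e : R, 0 < e -> exists N : nat, forall n : nat,
    (N <= n)%N -> unitz_norm (u n - v) < e.
Proof.
move=> uC.
have real_limit (f : R[i] -> R) : (forall l m, f (l - m) = f l - f m) ->
    (forall l, `|f l| <= rmod l) -> exists x : R, forall e, 0 < e ->
    exists N : nat, forall n : nat, (N <= n)%N -> `|f (u n).2 - x| < e.
  move=> fB fle; apply: (@seq_complete R R^o) => e e0.
  have [N uN] := uC e e0; exists N => m n Nm Nn.
  rewrite -fB (le_lt_trans (fle _))//.
  exact: le_lt_trans (rmod_le (u m - u n)) (uN m n Nm Nn).
have [p pP] : exists x : R, forall e, 0 < e -> exists N : nat,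
    forall n : nat, (N <= n)%N -> `|complex.Re (u n).2 - x| < e.
  apply: real_limit => [l m|l]; first by rewrite raddfB.
  by rewrite -lecR rmodE normc_ge_Re.
have [q qP] : exists x : R, forall e, 0 < e -> exists N : nat,
    forall n : nat, (N <= n)%N -> `|complex.Im (u n).2 - x| < e.
  apply: real_limit => [l m|l]; first by rewrite raddfB.
  exact: rmod_Im.
have [a aP] : exists a : A, forall e : R[i], 0 < e -> exists N : nat,
    forall n : nat, (N <= n)%N -> `|(u n).1 - a| < e.
  apply: seq_complete => e e0.
  have eE : e = (complex.Re e)%:C by rewrite RRe_real// gtr0_real.
  have e2 : 0 < complex.Re e / 2 by rewrite divr_gt0// -ltcR -eE.
  have [N uN] := uC _ e2; exists N => m n Nm Nn.
  rewrite eE -rnormE ltcR (le_lt_trans (rnorm_le_unitz_norm (u m - u n)))//.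
  by rewrite mulrC -ltr_pdivlMr// uN.
exists (a, Complex p q) => e e0.
have e3 : 0 < e / 3 by rewrite divr_gt0.
have e3C : 0 < ((e / 3)%:C : R[i]) by rewrite ltcR.
have [N1 N1P] := aP _ e3C; have [N2 N2P] := pP _ e3; have [N3 N3P] := qP _ e3.
exists (maxn N1 (maxn N2 N3)) => n; rewrite !geq_max => /and3P[n1 n2 n3].
rewrite (le_lt_trans (unitz_norm_split _))//=.
have := N1P n n1; rewrite -rnormE ltcR => h1.
have := rmod_Re_Im ((u n).2 - Complex p q).
have := N2P n n2; have := N3P n n3; rewrite !raddfB /=; lra.
Qed.

HB.instance Definition _ := isUnitalCStar.Build R U unitz_starK unitz_starD
  unitz_starZ unitz_starM unitz_normD unitz_normZ unitz_norm_eq0 unitz_normM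
  unitz_norm_starM unitz_complete.

End UnitzNorm.

(** * Gram matrices *)

Section Sums.
Variables (R : realType) (U : unitalCStarType R).

Lemma pos_sum n (f : 'I_n -> U) : (forall i, pos (f i)) -> pos (\sum_(i < n) f i).
Proof. by move=> fpos; apply: big_ind => //; [exact: pos0 | exact: posD]. Qed.

(** Summing [pos_cross] over all pairs [(i, j)] counts each entry of the quadratic
form twice, and by the symmetry of [||g i j||] bounds it by the sum of the row
sums times [a_i^* a_i]. *)
Lemma pos_gram n (a : 'I_n -> U) (g : 'I_n -> 'I_n -> U) (m : R) :
  (forall i j, star (g i j) = g j i) ->
  (forall i, \sum_(j < n) cnorm (g i j) <= m) ->
  pos (m%:C *: \sum_(i < n) star (a i) * a i -
       \sum_(i < n) \sum_(j < n) star (a i) * g i j * a j).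
Proof.
move=> sg gm.
pose p i := star (a i) * a i; pose c i j := (cnorm (g i j))%:C : R[i].
pose q i j := star (a i) * g i j * a j.
pose D := \sum_(i < n) (\sum_(j < n) cnorm (g i j))%:C *: p i.
pose Q := \sum_(i < n) \sum_(j < n) q i j.
have TE : \sum_(i < n) \sum_(j < n) (c i j *: (p i + p j) - (q i j + q j i)) =
    (D - Q) + (D - Q).
  transitivity (\sum_(i < n) ((\sum_(j < n) c i j *: p i - \sum_(j < n) q i j) +
      (\sum_(j < n) c i j *: p j - \sum_(j < n) q j i))).
    apply: eq_bigr => i _; rewrite -!sumrB -big_split; apply: eq_bigr => j _.
    by rewrite scalerDr opprD addrACA.
  rewrite big_split /= !sumrB; congr (_ - _ + (_ - _)).
  - by apply: eq_bigr => i _; rewrite -scaler_suml rmorph_sum.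
  - rewrite exchange_big; apply: eq_bigr => i _; rewrite /D rmorph_sum scaler_suml.
    by apply: eq_bigr => j _; rewrite /c -(sg i j) cnorm_star.
  - by rewrite exchange_big.
have -> : m%:C *: \sum_(i < n) p i - Q =
    \sum_(i < n) (m - \sum_(j < n) cnorm (g i j))%:C *: p i + (D - Q).
  rewrite addrA; congr (_ - _); rewrite -big_split scaler_sumr.
  by apply: eq_bigr => i _; rewrite /= -scalerDl -rmorphD subrK.
apply: posD.
  apply: pos_sum => i; apply: posZ; first by rewrite subr_ge0.
  exact: pos_starM.
rewrite -[D - Q]scale_half2 -TE; apply: posZ; first by rewrite invr_ge0.
apply: pos_sum => i; apply: pos_sum => j; rewrite /q -(sg i j).
exact: pos_cross.
Qed.

End Sums.

(** * Transfer to a possibly non-unital algebra *)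

Section Transfer.
Variables (R : realType) (A : cstarAlgType R).
Implicit Types (a b : A) (l : R[i]).

Definition emb a : unitz A := (a, 0).

Lemma embD a b : emb (a + b) = emb a + emb b.
Proof. by congr pair; rewrite /= addr0. Qed.

Lemma embZ l a : emb (l *: a) = l *: emb a.
Proof. by congr pair; rewrite /= scaler0. Qed.

Lemma embB a b : emb (a - b) = emb a - emb b.
Proof. by rewrite -scaleN1r embD embZ scaleN1r. Qed.

Lemma embM a b : emb (amul a b) = emb a * emb b.
Proof. by congr pair; rewrite /= ?mulr0 // !scale0r !addr0. Qed.

Lemma emb_star a : emb (astar a) = star (emb a).
Proof. by congr pair; rewrite conjC0. Qed.

Lemma emb0 : emb 0 = 0. Proof. by []. Qed.

Lemma emb_sum n (f : 'I_n -> A) :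
  emb (\sum_(i < n) f i) = \sum_(i < n) emb (f i).
Proof. exact: (big_morph emb embD emb0). Qed.

Lemma cnorm_emb a : cnorm (emb a) = rnorm a.
Proof. exact: unitz_norm_inl. Qed.

Lemma emb_scalar a l : ((a, - l) : unitz A) = emb a - l%:A.
Proof.
congr pair; rewrite /= ?scaler0 ?subr0// sub0r.
by congr (- _); exact/esym/mulr1.
Qed.

Lemma apositiveP a : apositive a <-> pos (emb a).
Proof.
split=> [[sa spec]|apos].
  apply: pos_resolvent => [|s s0]; first by rewrite -emb_star sa.
  have [/spec|] := pselect (spectrum a (- s%:C)).
    by rewrite oppr_ge0 -(rmorph0 (real_complex R)) lecR leNgt s0.
  by move/contrapT; rewrite /unitz_invertible emb_scalar scaleNr opprK.
split; first by have := pos_star apos; rewrite -emb_star => -[].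
move=> l; rewrite /spectrum /= emb_scalar => ninv.
by apply: contrapT => l0; apply: ninv; exact: (pos_spectrum apos l0).
Qed.

(** The square root taken in the unitization lies in [A]: its scalar part squares
to that of [a], which is [0]. *)
Lemma asqr_asqrt a : apositive a -> asqr (asqrt a) = a.
Proof.
move=> /apositiveP/pos_sqrt[[b l] [bpos bb _]].
have l0 : l = 0.
  by move: bb => /(congr1 snd)/eqP; rewrite /= mulf_eq0 orbb => /eqP.
rewrite l0 in bpos bb.
have ex : exists c : A, apositive c /\ amul c c = a.
  exists b; split; first exact/apositiveP.
  by move: bb; rewrite -/(emb b) -embM => -[].
by have [] := xgetPex (0 : A) ex.
Qed.

Lemma asqr_aabs a : asqr (aabs a) = amul (astar a) a.
Proof.
apply: asqr_asqrt; apply/apositiveP; rewrite embM emb_star; exact: pos_starM.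
Qed.

End Transfer.

(** * Hilbert modules *)

Section Module.
Variables (R : realType) (A : cstarAlgType R) (X : hilbertModType A).
Implicit Types (x y z : X) (a b : A) (l : R[i]).

Local Notation ip x y := (inner x y : A).

Lemma innerDr x y z : ip x (y + z) = ip x y + ip x z.
Proof. by rewrite -[y]scale1r inner_linear !scale1r. Qed.

Lemma inner0r x : ip x 0 = 0.
Proof. by apply: (addrI (ip x 0)); rewrite -innerDr !addr0. Qed.

Lemma innerZr l x y : ip x (l *: y) = l *: ip x y.
Proof. by have := inner_linear l x y 0; rewrite inner0r !addr0. Qed.

Lemma innerBr x y z : ip x (y - z) = ip x y - ip x z.
Proof. by rewrite -scaleN1r innerDr innerZr scaleN1r. Qed.

Lemma inner_sumr n x (f : 'I_n -> X) :
  ip x (\sum_(i < n) f i) = \sum_(i < n) ip x (f i).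
Proof. exact: (big_morph (inner x) (innerDr x) (inner0r x)). Qed.

Lemma astar_sum n (f : 'I_n -> A) :
  astar (\sum_(i < n) f i) = \sum_(i < n) astar (f i).
Proof. exact: (big_morph astar (@astarD R A) (astar0 A)). Qed.

Lemma inner_suml n x (f : 'I_n -> X) :
  ip (\sum_(i < n) f i) x = \sum_(i < n) ip (f i) x.
Proof.
rewrite -inner_star inner_sumr astar_sum.
by apply: eq_bigr => i _; rewrite inner_star.
Qed.

Lemma inner_ractl x y a : ip (ract x a) y = amul (astar a) (ip x y).
Proof. by rewrite -inner_star inner_ract astarM inner_star. Qed.

Lemma pos_inner x : pos (emb (ip x x)).
Proof. by apply/apositiveP; exact: inner_ge0. Qed.

(** For [k > 0], expand [<w, w> >= 0] at [w := k x - z <z, x>] and bound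
[<x, z> <z, z> <z, x>] by [k <x, z> <z, x>]; the result is the claim multiplied
by [k].  The case [k = 0] forces [z = 0]. *)
Lemma cauchy_schwarz x z (k : R) : 0 <= k -> rnorm (ip z z) <= k ->
  pos (emb (k%:C *: ip x x - amul (ip x z) (ip z x))).
Proof.
rewrite le_eqVlt => /predU1P[<-|k0] zk.
  have z0 : z = 0.
    apply/inner_eq0; apply: rnorm_eq0; apply/eqP.
    by rewrite eq_le zk rnorm_ge0.
  rewrite z0 inner0r amul0l scale0r subr0; exact: pos0.
set a := ip z x; set w := k%:C *: x - ract z a.
have xz : ip x z = astar a by rewrite inner_star.
have wz : ip w z = k%:C *: astar a - amul (astar a) (ip z z).
  by rewrite -inner_star innerBr innerZr inner_ract astarB astarZ conj_real
    astarM (inner_star z z).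
have wx : ip w x = k%:C *: ip x x - amul (astar a) a.
  by rewrite -inner_star innerBr innerZr inner_ract astarB astarZ conj_real
    astarM !inner_star.
have ww : emb (ip w w) = k%:C *: (k%:C *: emb (ip x x) - emb (amul (astar a) a))
    - (k%:C *: emb (amul (astar a) a) - star (emb a) * emb (ip z z) * emb a).
  rewrite {2}/w innerBr innerZr inner_ract wx wz !(embB, embZ, embM) emb_star.
  by rewrite mulrBl -scalerAl.
have gpos := @pos_conj _ _ _ (emb a) (pos_scalarB (pos_star (pos_inner z)) _).
have := posD (pos_inner w) (gpos k _); rewrite cnorm_emb => /(_ zk).
rewrite ww mulrBr mulrBl mulr_algr -scalerAl -emb_star -!embM.
rewrite subrK => h.
have := posZ (r := k^-1) _ h; rewrite invr_ge0 ltW// => /(_ isT).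
by rewrite scalerA -rmorphM mulVf ?gt_eqF// scale1r embB embZ xz.
Qed.

End Module.

Lemma bigmax_real (R : realType) n (f : 'I_n -> R) :
  \big[Num.max/0]_(i < n) (f i)%:C = (\big[Num.max/0]_(i < n) f i)%:C :> R[i].
Proof.
apply/esym/(big_morph (real_complex R)) => // r s.
by rewrite !maxEle lecR; case: ifP.
Qed.

Theorem corollary3p4 (R : realType) (A : cstarAlgType R)
    (X : hilbertModType A) (n : nat) (n_gt0 : (0 < n)%N)
    (x : X) (y : 'I_n -> X) :
  ale (asqr (\sum_(i < n) asqr (aabs (inner (y i) x : A))))
      ((`|\sum_(i < n) asqr (aabs (inner (y i) x : A))|
        * \big[Num.max/0]_(i < n) \sum_(j < n) `|inner (y i) (y j) : A|)
       *: asqr (mabs x)).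
Proof.
pose a i : A := inner (y i) x.
pose g i j : A := inner (y i) (y j).
pose z : X := \sum_(i < n) ract (y i) (a i).
set S := \sum_(i < n) _.
have SE : S = \sum_(i < n) amul (astar (a i)) (a i).
  by apply: eq_bigr => i _; rewrite asqr_aabs.
have Sxz : S = inner x z.
  by rewrite SE inner_sumr; apply: eq_bigr => i _; rewrite inner_ract inner_star.
have sS : astar S = S.
  by rewrite SE astar_sum; apply: eq_bigr => i _; rewrite astarM astarK.
pose m : R := \big[Num.max/0]_(i < n) \sum_(j < n) rnorm (g i j).
have -> : \big[Num.max/0]_(i < n) \sum_(j < n) `|g i j| = m%:C.
  rewrite -bigmax_real; apply: eq_bigr => i _; rewrite rmorph_sum.
  by apply: eq_bigr => j _; rewrite /= rnormE.
have m0 : 0 <= m by exact: bigmax_ge_id.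
have zS : rnorm (inner z z : A) <= m * rnorm S.
  rewrite -!cnorm_emb -[X in X * _](ger0_norm m0) -cnormZr.
  apply: pos_cnorm_le; first exact: pos_inner.
  have -> : emb (inner z z) =
      \sum_(i < n) \sum_(j < n) star (emb (a i)) * emb (g i j) * emb (a j).
    rewrite inner_suml emb_sum; apply: eq_bigr => i _.
    rewrite inner_ractl inner_sumr embM emb_star emb_sum mulr_sumr.
    by apply: eq_bigr => j _; rewrite inner_ract embM mulrA.
  have -> : emb S = \sum_(i < n) star (emb (a i)) * emb (a i).
    by rewrite SE emb_sum; apply: eq_bigr => i _; rewrite embM emb_star.
  apply: pos_gram => [i j|i]; first by rewrite -emb_star inner_star.
  under eq_bigr do rewrite cnorm_emb.
  exact: (le_bigmax _ (fun i => \sum_(j < n) rnorm (g i j))).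
rewrite /mabs asqr_asqrt; last exact: inner_ge0.
rewrite -rnormE -rmorphM mulrC /ale /asqr; apply/apositiveP.
have := cauchy_schwarz x (mulr_ge0 m0 (rnorm_ge0 S)) zS.
by rewrite -(inner_star x z) -Sxz sS.
Qed.
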